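(* Let $(R,\mathfrak{m},k)$ be a commutative Noetherian local ring which is Artinian and satisfies $\mathfrak{m}^4=0$. If $\operatorname{ld}_R(k)<\infty$, then $\operatorname{ld}_R(k)=0$.
   Context: Let $(R,\mathfrak{m},k)$ be a commutative Noetherian local ring. Let $R^{\mathsf g}=\bigoplus_{i\ge0}\mathfrak{m}^i/\mathfrak{m}^{i+1}$ be the associated graded ring. For a minimal complex $\mathbf{F}:\cdots\to F_n\xrightarrow{\partial_n}F_{n-1}\to\cdots\to F_0\to 0$ of finitely generated free $R$-modules (minimal means $\partial_i(F_i)\subseteq\mathfrak{m}F_{i-1}$ for all $i$), consider the filtration $\mathfrak{F}^p\mathbf{F}$ with $(\mathfrak{F}^p\mathbf{F})_i=\mathfrak{m}^{p-i}F_i$ (with $\mathfrak{m}^j=R$ for $j\le 0$). The associated graded complex with respect to this filtration is the linear part $\operatorname{lin}^R(\mathbf{F})$; it is a complex of graded free $R^{\mathsf g}$-modules with $\operatorname{lin}^R_n(\mathbf{F})=F_n^{\mathsf g}(-n)$, where $F_n^{\mathsf g}=\bigoplus_{i\ge0}\mathfrak{m}^iF_n/\mathfrak{m}^{i+1}F_n$; its differential sends the class of $x\in\mathfrak{m}^iF_n$ in $\mathfrak{m}^iF_n/\mathfrak{m}^{i+1}F_n$ to the class of $\partial(x)$ in $\mathfrak{m}^{i+1}F_{n-1}/\mathfrak{m}^{i+2}F_{n-1}$. For a finitely generated $R$-module $M$ with minimal free resolution $\mathbf{F}$, the linearity defect is $\operatorname{ld}_R(M)=\sup\{i\in\mathbb{Z}: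 \operatorname{H}_i(\operatorname{lin}^R(\mathbf{F}))\neq 0\}$ (possibly infinite). *)

(* Defs.v *)
From HB Require Import structures.
From mathcomp Require Import all_boot all_order all_algebra.
Set Implicit Arguments. Unset Strict Implicit. Unset Printing Implicit Defensive.
Import GRing.Theory.
Local Open Scope ring_scope.

Section LocalRings.
Variable R : comUnitRingType.

(* Local ring: the non-units form an ideal (closed under addition; closure
   under multiplication by ring elements is automatic in a commutative ring).
   The maximal ideal m is then the set of non-units. *)
Definition is_local : Prop :=
  forall x y : R, x \isn't a GRing.unit -> y \isn't a GRing.unit ->
    (x + y) \isn't a GRing.unit.

Definition in_m (x : R) : Prop := x \isn't a GRing.unit.

Fixpoint mpow (p : nat) : R -> Prop :=
  match p with
  | 0 => fun _ => True
  | p'.+1 => fun x => exists (n : nat) (a c : 'I_n -> R),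
      (forall i, in_m (a i)) /\ (forall i, mpow p' (c i)) /\
      x = \sum_(i < n) a i * c i
  end.

Definition is_ideal (I : R -> Prop) : Prop :=
  I 0 /\ (forall x y, I x -> I y -> I (x + y)) /\ (forall a x, I x -> I (a * x)).

Definition noetherian : Prop :=
  forall I : R -> Prop, is_ideal I ->
    exists (n : nat) (g : 'I_n -> R),
      forall x, I x <-> exists c : 'I_n -> R, x = \sum_(i < n) c i * g i.

Definition artinian : Prop :=
  forall I : nat -> R -> Prop, (forall n, is_ideal (I n)) ->
    (forall n x, I n.+1 x -> I n x) ->
    exists N, forall n x, (N <= n)%N -> I n x -> I N x.

Definition rv_in_mpow (p : nat) (n : nat) (x : 'rV[R]_n) : Prop :=
  forall j, mpow p (x 0 j).

(* A complex of finitely generated free modules F_n = R^(b n), with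
   differential  del_(n+1) : F_(n+1) -> F_n,  x |-> x *m d n. *)
Definition is_complex (b : nat -> nat) (d : forall n, 'M[R]_(b n.+1, b n)) : Prop :=
  forall n, d n.+1 *m d n = 0.

Definition is_minimal (b : nat -> nat) (d : forall n, 'M[R]_(b n.+1, b n)) : Prop :=
  forall n i j, in_m (d n i j).

(* (F, d) is a free resolution of k = R/m with augmentation
   eps : F_0 -> k, x |-> (x *m e) mod m  (an R-linear map R^(b 0%N) -> R/m):
   exact in positive degrees, eps surjective (nonzero onto the simple
   module k) and ker eps = im del_1. *)
Definition is_free_resolution_of_k (b : nat -> nat)
    (d : forall n, 'M[R]_(b n.+1, b n)) (e : 'cV[R]_(b 0%N)) : Prop :=
  [/\ is_complex d,
      forall n (x : 'rV[R]_(b n.+1)), x *m d n = 0 ->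
        exists y : 'rV[R]_(b n.+2), x = y *m d n.+1,
      exists x : 'rV[R]_(b 0%N), ~ in_m ((x *m e) 0 0) &
      forall x : 'rV[R]_(b 0%N),
        in_m ((x *m e) 0 0) <-> exists y : 'rV[R]_(b 1), x = y *m d 0].

(* H_i(lin^R(F)) <> 0: some graded piece of internal degree i+p (p >= 0) of
   the homology is nonzero.  That piece is the homology of
     m^(p-1)F_(i+1)/m^p F_(i+1) -> m^p F_i/m^(p+1) F_i -> m^(p+1)F_(i-1)/m^(p+2)F_(i-1)
   where the left module is 0 when p = 0 and the right one is 0 when i = 0. *)
Definition lin_cycle_cond (b : nat -> nat) (d : forall n, 'M[R]_(b n.+1, b n))
    (p i : nat) : 'rV[R]_(b i) -> Prop :=
  match i return 'rV[R]_(b i) -> Prop with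
  | 0 => fun _ => True
  | n.+1 => fun x => rv_in_mpow p.+2 (x *m d n)
  end.

Definition lin_homology_nonzero (b : nat -> nat)
    (d : forall n, 'M[R]_(b n.+1, b n)) (i : nat) : Prop :=
  exists (p : nat) (x : 'rV[R]_(b i)),
    [/\ rv_in_mpow p x, lin_cycle_cond d p x &
        ~ (exists (y : 'rV[R]_(b i.+1)) (z : 'rV[R]_(b i)),
              [/\ (0 < p)%N \/ y = 0, rv_in_mpow p.-1 y, rv_in_mpow p.+1 z &
                  x = y *m d i + z])].

(* ld(F) <= N  (as sup{i : H_i(lin F) <> 0}; homology vanishes in negative degrees). *)
Definition ld_le (b : nat -> nat) (d : forall n, 'M[R]_(b n.+1, b n)) (N : nat) : Prop :=
  forall i, (N < i)%N -> ~ lin_homology_nonzero d i.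

Definition ld_finite (b : nat -> nat) (d : forall n, 'M[R]_(b n.+1, b n)) : Prop :=
  exists N, ld_le d N.

Definition ld_eq0 (b : nat -> nat) (d : forall n, 'M[R]_(b n.+1, b n)) : Prop :=
  lin_homology_nonzero d 0 /\ ld_le d 0.

End LocalRings.

(* Main.v *)
(** Let F be the minimal free resolution of k, and say that (k, i) is exact when
    every cycle of F_i with entries in m^(k+1) is the boundary of an element with
    entries in m^k.  As m^4 = 0, vanishing of H_i(lin F) for all i > 0 is
    equivalent to exactness of (1, i) and (2, i) for all i, and finiteness of the
    linearity defect gives it for large i.

    To descend, take y in F_j outside m F_j with m^(k+1) dy = 0, and suppose that
    (k, i) is exact for i >= j.  There is a Leibniz product F_(>= j) x F -> F with
    y x = x.  If u is a cycle of F_i with entries in m^(k+1), then y (x) u is a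
    cycle of F_(>= j) (x) F, and a zigzag along the first factor writes it as a
    boundary of elements with entries in m^k; its image u under the product is
    then such a boundary too.  So (k, i) is exact for all i.

    For k = 2 any basis vector y of high degree will do.  For k = 1, if (1, n) is
    the last failure, witnessed by u = dy with y not in m F_(n+1), then
    m^2 dy = 0 and this very y shows that (1, n) is exact. *)

Require Import Defs.
From HB Require Import structures.
From mathcomp Require Import all_boot all_order all_algebra.
From Stdlib Require Import ClassicalEpsilon.
Set Implicit Arguments. Unset Strict Implicit. Unset Printing Implicit Defensive.
Import GRing.Theory.
Local Open Scope ring_scope.

(** * Powers of the maximal ideal, for scalars and for matrices *)

Section MaximalIdeal.
Variable R : comUnitRingType.
Hypothesis Hloc : is_local R.

Lemma in_m0 : in_m (0 : R).
Proof. by rewrite /in_m unitr0. Qed.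

Lemma in_mMl (a x : R) : in_m x -> in_m (a * x).
Proof. by rewrite /in_m unitrM negb_and => ->; rewrite orbT. Qed.

Lemma mpow0 p : mpow p (0 : R).
Proof.
case: p => [//|p]; exists 0%N, (fun=> 0), (fun=> 0).
by split=> [[]//|]; split=> [[]//|]; rewrite big_ord0.
Qed.

Lemma mpowMl p (a x : R) : mpow p x -> mpow p (a * x).
Proof.
elim: p x => [//|p IH] x [n [u [c [hu [hc ->]]]]].
exists n, u, (fun i => a * c i); split=> //; split=> [i|]; first exact: IH (hc i).
by rewrite mulr_sumr; apply: eq_bigr => i _; rewrite mulrCA.
Qed.

Lemma mpowD p (x y : R) : mpow p x -> mpow p y -> mpow p (x + y).
Proof.
case: p => [//|p] [n1 [u1 [c1 [hu1 [hc1 ->]]]]] [n2 [u2 [c2 [hu2 [hc2 ->]]]]].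
pose glue (f : 'I_n1 -> R) (g : 'I_n2 -> R) (i : 'I_(n1 + n2)) :=
  match split i with inl j => f j | inr k => g k end.
exists (n1 + n2)%N, (glue u1 u2), (glue c1 c2); rewrite /glue; split=> [i|].
  by case: split.
split=> [i|]; first by case: split.
rewrite big_split_ord /=; congr (_ + _); apply: eq_bigr => i _.
  by rewrite (unsplitK (inl i)).
by rewrite (unsplitK (inr i)).
Qed.

Lemma mpowN p (x : R) : mpow p x -> mpow p (- x).
Proof. by rewrite -mulN1r; exact: mpowMl. Qed.

Lemma mpow_sum p n (f : 'I_n -> R) :
  (forall i, mpow p (f i)) -> mpow p (\sum_i f i).
Proof.
by move=> hf; apply: (big_ind (mpow p)) => //; [exact: mpow0|exact: mpowD].
Qed.

Lemma mpow_pred p (x : R) : mpow p.+1 x -> mpow p x.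
Proof.
move=> [n [u [c [_ [hc ->]]]]]; apply: mpow_sum => i; exact: mpowMl (hc i).
Qed.

Lemma mpowM p q (x y : R) : mpow p x -> mpow q y -> mpow (p + q) (x * y).
Proof.
elim: p x => [|p IH] x; first by move=> _; exact: mpowMl.
move=> [n [u [c [hu [hc ->]]]]] hy; rewrite mulr_suml.
exists n, u, (fun i => c i * y); split=> //; split=> [i|]; first exact: IH _ (hc i) hy.
by apply: eq_bigr => i _; rewrite mulrA.
Qed.

Lemma mpow1P (x : R) : mpow 1 x <-> in_m x.
Proof.
split=> [[n [u [c [hu [_ ->]]]]]|hx].
  apply: (big_ind (fun z : R => in_m z)) => [|y z|i _]; first exact: in_m0.
  - exact: Hloc.
  - by rewrite mulrC; exact: in_mMl.
exists 1%N, (fun=> x), (fun=> 1); do !split=> //.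
by rewrite big_ord1 mulr1.
Qed.

Definition mx_in_mpow p m n (A : 'M[R]_(m, n)) : Prop :=
  forall i j, mpow p (A i j).

Lemma mx_in_mpowM p q m n l (A : 'M[R]_(m, n)) (B : 'M[R]_(n, l)) :
  mx_in_mpow p A -> mx_in_mpow q B -> mx_in_mpow (p + q) (A *m B).
Proof.
move=> hA hB i j; rewrite mxE; apply: mpow_sum => k.
exact: mpowM (hA i k) (hB k j).
Qed.

Lemma mx_in_mpow0 m n (A : 'M[R]_(m, n)) : mx_in_mpow 0 A.
Proof. by []. Qed.

Lemma mx_in_mpowMr p m n l (A : 'M[R]_(m, n)) (B : 'M[R]_(n, l)) :
  mx_in_mpow p A -> mx_in_mpow p (A *m B).
Proof.
by move=> hA; rewrite -[p]addn0; apply: mx_in_mpowM (mx_in_mpow0 B).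
Qed.

Lemma mx_in_mpowMl p m n l (A : 'M[R]_(m, n)) (B : 'M[R]_(n, l)) :
  mx_in_mpow p B -> mx_in_mpow p (A *m B).
Proof. exact: (mx_in_mpowM (mx_in_mpow0 A)). Qed.

Lemma mx_in_mpowD p m n (A B : 'M[R]_(m, n)) :
  mx_in_mpow p A -> mx_in_mpow p B -> mx_in_mpow p (A + B).
Proof. by move=> hA hB i j; rewrite mxE; apply: mpowD. Qed.

Lemma mx_in_mpowN p m n (A : 'M[R]_(m, n)) :
  mx_in_mpow p A -> mx_in_mpow p (- A).
Proof. by move=> hA i j; rewrite mxE; apply: mpowN. Qed.

Lemma mx_in_mpowZ p m n (a : R) (A : 'M[R]_(m, n)) :
  mx_in_mpow p A -> mx_in_mpow p (a *: A).
Proof. by move=> hA i j; rewrite mxE; apply: mpowMl. Qed.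

Lemma mx_in_mpow_sum p m n l (A : 'I_l -> 'M[R]_(m, n)) :
  (forall i, mx_in_mpow p (A i)) -> mx_in_mpow p (\sum_i A i).
Proof. by move=> hA i j; rewrite summxE; apply: mpow_sum => k; apply: hA. Qed.

Lemma mx_in_mpow_row p m n (A : 'M[R]_(m, n)) a :
  mx_in_mpow p A -> mx_in_mpow p (row a A).
Proof. by move=> hA i j; rewrite mxE. Qed.

Lemma mx_in_mpow_tr p m n (A : 'M[R]_(m, n)) :
  mx_in_mpow p A -> mx_in_mpow p A^T.
Proof. by move=> hA i j; rewrite mxE. Qed.

Lemma rv_in_mpowP p n (x : 'rV[R]_n) : rv_in_mpow p x <-> mx_in_mpow p x.
Proof. by split=> hx; [move=> i j; rewrite ord1; apply: hx|move=> j]. Qed.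

End MaximalIdeal.

(** * The minimal resolution of the residue field *)

Section MinimalResolution.
Variables (R : comUnitRingType) (b : nat -> nat).
Variables (d : forall n, 'M[R]_(b n.+1, b n)) (e : 'cV[R]_(b 0%N)).
Hypotheses (Hloc : is_local R) (Hres : is_free_resolution_of_k d e).
Hypothesis Hmin : is_minimal d.

(* In degree 0 this is the kernel of the augmentation, by minimality. *)
Definition cycle n : 'rV[R]_(b n) -> Prop :=
  match n return 'rV[R]_(b n) -> Prop with
  | 0 => fun x => mx_in_mpow 1 x
  | m.+1 => fun x => x *m d m = 0
  end.

Lemma d_in_m n : mx_in_mpow 1 (d n).
Proof. by move=> i j; apply/mpow1P. Qed.

Lemma dd n : d n.+1 *m d n = 0.
Proof. by case: Hres => h *; exact: h. Qed.

Lemma cycle_boundary n (x : 'rV[R]_(b n)) :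
  cycle x -> exists y, x = y *m d n.
Proof.
case: Hres => _ hex _ h0; case: n x => [|n] x /= hx; last exact: hex.
apply/h0/mpow1P => //; exact: mx_in_mpowMr.
Qed.

Lemma boundary_cycle n (y : 'rV[R]_(b n.+1)) : cycle (y *m d n).
Proof.
case: n y => [|n] y /=; last by rewrite -mulmxA dd mulmx0.
apply: mx_in_mpowMl; exact: d_in_m.
Qed.

Definition pow_exact k n : Prop := forall x : 'rV[R]_(b n),
  mx_in_mpow k.+1 x -> cycle x -> exists v, mx_in_mpow k v /\ x = v *m d n.

(** * Lifting through the differential, and null-homotopies *)

Lemma cycle_boundary_mx q n (X : 'M[R]_(q, b n)) :
  (forall a, cycle (row a X)) -> exists Y, X = Y *m d n.
Proof.
move=> hX; have [f hf] := fin_all_exists (fun a => cycle_boundary (hX a)).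
exists (\matrix_a f a); apply/row_matrixP => a.
by rewrite row_mul rowK.
Qed.

(** A preimage chosen without a proof that one exists, so that [null_homotopy] can be a plain
    recursion. *)
Definition lift q n (X : 'M[R]_(q, b n)) : 'M[R]_(q, b n.+1) :=
  epsilon (inhabits 0) (fun Y => X = Y *m d n).

Lemma liftK q n (X : 'M[R]_(q, b n)) :
  (forall a, cycle (row a X)) -> lift X *m d n = X.
Proof.
by move=> hX; rewrite [RHS](epsilon_spec (inhabits 0) _ (cycle_boundary_mx hX)).
Qed.

(* A family of matrices indexed by all pairs of degrees encodes an endomorphism
   of the total module; its homogeneity never needs to be recorded. *)
Definition endo := forall r n, 'M[R]_(b r, b n).

(** Chain maps up to the scalar [s]. The last two clauses are the edge cases: elements of F_0 go to
    cycles, and components in F_0 are cycles in the sense of [cycle]. *)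
Definition chain_endo (s : R) (G : endo) : Prop :=
  [/\ forall r n, G r.+1 n.+1 *m d n = s *: (d r *m G r n),
      forall n, G 0%N n.+1 *m d n = 0 &
      forall r, mx_in_mpow 1 (G r 0%N)].

Fixpoint null_homotopy (s : R) (G : endo) (r : nat) : forall n, 'M[R]_(b r, b n) :=
  match r with
  | 0 => fun n => match n with
                  | 0 => 0
                  | n'.+1 => lift (G 0%N n')
                  end
  | r'.+1 => fun n => match n with
                  | 0 => 0
                  | n'.+1 => lift (G r'.+1 n' - s *: (d r' *m null_homotopy s G r' n'))
                  end
  end.

Lemma cycle_row_mx q n (X : 'M[R]_(q, b n)) :
  match n return 'M[R]_(q, b n) -> Prop with
  | 0 => fun X => mx_in_mpow 1 X
  | m.+1 => fun X => X *m d m = 0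
  end X -> forall a, cycle (row a X).
Proof.
case: n X => [|n] X hX a /=; first exact: mx_in_mpow_row.
by rewrite -row_mul hX row0.
Qed.

(** Each matrix to be lifted has cycles as rows: in degree 0 because its entries lie in m, and in
    higher degrees because the chain condition cancels against the preceding homotopy identity. *)
Lemma null_homotopyP (s : R) (G : endo) : chain_endo s G ->
  (forall n, null_homotopy s G 0 n.+1 *m d n = G 0%N n) /\
  (forall r n, null_homotopy s G r.+1 n.+1 *m d n =
     G r.+1 n - s *: (d r *m null_homotopy s G r n)).
Proof.
move=> [hG hG0 hGm].
have H0 n : null_homotopy s G 0 n.+1 *m d n = G 0%N n.
  by apply/liftK/cycle_row_mx; case: n.
split=> // r; elim: r => [|r IH] n; apply/liftK/cycle_row_mx; case: n => [|n].
- apply: mx_in_mpowD => //; apply/mx_in_mpowN/mx_in_mpowZ/mx_in_mpowMr.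
  exact: d_in_m.
- by rewrite mulmxBl hG -scalemxAl -mulmxA H0 subrr.
- apply: mx_in_mpowD => //; apply/mx_in_mpowN/mx_in_mpowZ/mx_in_mpowMr.
  exact: d_in_m.
- rewrite mulmxBl hG -scalemxAl -mulmxA IH mulmxBr -scalemxAr mulmxA dd.
  by rewrite mul0mx scaler0 subr0 subrr.
Qed.

(** * The product of F_(>= j) with F *)

Section Product.
Variables (j : nat) (y : 'rV[R]_(b j)) (a0 : 'I_(b j)).
Hypothesis ya0 : y 0 a0 \is a GRing.unit.

(* [prod_endo p a] is multiplication by the [a]-th basis vector of F_(p + j),
   where the product F_(>= j) x F -> F extends (f, x) |-> l(f) x for a linear
   form l on F_j with l(y) = 1. *)
Fixpoint prod_endo (p : nat) : 'I_(b (p + j)) -> endo :=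
  match p return 'I_(b (p + j)) -> endo with
  | 0 => fun a r n => if r == n then ((a == a0)%:R / y 0 a0) *: pid_mx (b r) else 0
  | p'.+1 => fun a => null_homotopy ((-1) ^+ p')
      (fun r n => \sum_c d (p' + j) a c *: prod_endo c r n)
  end.

Lemma prod_endo0_chain a r n :
  @prod_endo 0 a r.+1 n.+1 *m d n = d r *m @prod_endo 0 a r n.
Proof.
rewrite /= eqSS; case: eqVneq => [<-|_]; last by rewrite mul0mx mulmx0.
by rewrite !pid_mx_1 -scalemxAl -scalemxAr mul1mx mulmx1.
Qed.

Definition prod_endo_d p (a : 'I_(b (p.+1 + j))) : endo :=
  fun r n => \sum_c d (p + j) a c *: prod_endo c r n.

Lemma prod_endo_d_in_m p (a : 'I_(b (p.+1 + j))) r n :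
  mx_in_mpow 1 (prod_endo_d a r n).
Proof.
apply: mx_in_mpow_sum => c k l; rewrite mxE mulrC.
by apply: mpowMl; apply: d_in_m.
Qed.

Lemma prod_endo_dd p (a : 'I_(b (p.+2 + j))) r n :
  \sum_c d (p.+1 + j) a c *: prod_endo_d (c : 'I_(b (p.+1 + j))) r n = 0.
Proof.
under eq_bigr => c _ do rewrite scaler_sumr.
rewrite exchange_big big1 //= => c _.
under eq_bigr => k _ do rewrite scalerA.
by rewrite -scaler_suml; have /matrixP/(_ a c) := dd (p + j); rewrite !mxE => ->;
  rewrite scale0r.
Qed.

(** Induction on p: the homotopy identities one degree lower are a Leibniz rule. Summed against the
    coefficients of a boundary, their d d terms vanish, and the rest is the chain condition with the
    opposite sign. *)
Lemma prod_endo_d_chain p (a : 'I_(b (p.+1 + j))) :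
  chain_endo ((-1) ^+ p) (prod_endo_d a).
Proof.
elim: p a => [|p IH] a; split=> [r n|n|r]; try exact: prod_endo_d_in_m.
- rewrite scale1r mulmx_suml mulmx_sumr; apply: eq_bigr => c _.
  by rewrite -scalemxAl (prod_endo0_chain c) scalemxAr.
- rewrite mulmx_suml big1 // => c _.
  by rewrite -scalemxAl /= mul0mx scaler0.
- have step (c : 'I_(b (p.+1 + j))) : prod_endo c r.+1 n.+1 *m d n =
      prod_endo_d c r.+1 n - (-1) ^+ p *: (d r *m prod_endo c r n).
    by have [_ ->] := null_homotopyP (IH c).
  rewrite -[RHS]add0r -(prod_endo_dd a r.+1 n).
  rewrite mulmx_suml mulmx_sumr scaler_sumr -big_split; apply: eq_bigr => c _ /=.
  rewrite -scalemxAl step scalerDr -scalemxAr exprS mulN1r scaleNr.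
  by rewrite scalerN !scalerA mulrC.
- rewrite -(prod_endo_dd a 0 n) mulmx_suml; apply: eq_bigr => c _.
  by rewrite -scalemxAl; have [-> _] := null_homotopyP (IH c).
Qed.

(* A matrix in 'M_(b p, b r) is an element of the tensor product of F_p and F_r. *)
Definition prod_tensor p r n (W : 'M[R]_(b (p + j), b r)) : 'rV[R]_(b n) :=
  \sum_a row a W *m prod_endo a r n.

(** On tensors written as matrices, d (x) 1 is left multiplication by the transpose of d, and 1 (x)
    d is right multiplication by d. *)
Lemma prod_tensor_tr_d p r n (V : 'M[R]_(b (p.+1 + j), b r)) :
  \sum_a row a V *m prod_endo_d a r n = prod_tensor n ((d (p + j))^T *m V).
Proof.
rewrite /prod_tensor; under eq_bigr => a _ do rewrite mulmx_sumr.
rewrite exchange_big; apply: eq_bigr => c _ /=.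
rewrite row_mul [row c _ *m V]mulmx_sum_row mulmx_suml; apply: eq_bigr => a _.
by rewrite !mxE -scalemxAl scalemxAr.
Qed.

Lemma prod_tensor0_d p n (V : 'M[R]_(b (p.+1 + j), b 0%N)) :
  prod_tensor n.+1 V *m d n = prod_tensor n ((d (p + j))^T *m V).
Proof.
rewrite -prod_tensor_tr_d mulmx_suml; apply: eq_bigr => a _.
by rewrite -mulmxA; have [-> _] := null_homotopyP (prod_endo_d_chain a).
Qed.

(** The Leibniz rule, with F_(p + 1 + j) counted in degree p + 1. *)
Lemma prod_tensorS_d p r n (V : 'M[R]_(b (p.+1 + j), b r.+1)) :
  prod_tensor n.+1 V *m d n =
  prod_tensor n ((d (p + j))^T *m V) - (-1) ^+ p *: prod_tensor n (V *m d r).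
Proof.
rewrite -prod_tensor_tr_d mulmx_suml scaler_sumr -sumrB; apply: eq_bigr => a _.
rewrite -mulmxA; have [_ ->] := null_homotopyP (prod_endo_d_chain a).
by rewrite mulmxBr -scalemxAr row_mul mulmxA.
Qed.

Lemma prod_tensor_in_mpow k p r n (W : 'M[R]_(b (p + j), b r)) :
  mx_in_mpow k W -> mx_in_mpow k (prod_tensor n W).
Proof.
move=> hW; apply: mx_in_mpow_sum => a.
exact/mx_in_mpowMr/mx_in_mpow_row.
Qed.

(** The form l reads the coordinate at [a0] and divides by the unit [y 0 a0], so l(y) = 1. *)
Lemma prod_tensor_unit r (u : 'rV[R]_(b r)) :
  prod_tensor (p := 0) r (y^T *m u) = u.
Proof.
rewrite /prod_tensor (bigD1 a0) //= big1 ?addr0 => [|a /negPf na]; last first.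
  by rewrite na eqxx mul0r scale0r mulmx0.
rewrite !eqxx mul1r pid_mx_1 -scalemxAr mulmx1 row_mul.
have -> : row a0 y^T = (y 0 a0)%:M.
  by apply/matrixP => k l; rewrite !mxE !ord1 eqxx mulr1n.
by rewrite mul_scalar_mx scalerA mulVr // scale1r.
Qed.

(** * The zigzag and the descent of exactness *)

Section Zigzag.
Variable k : nat.
Hypothesis exact_ge : forall p, pow_exact k (p + j).

(** The columns of [W] are elements of F_(p + j), and exactness there lifts them one by one. *)
Lemma pow_exact_tensor p r (W : 'M[R]_(b (p + j), b r)) :
  mx_in_mpow k.+1 W -> (forall c, cycle (row c W^T)) ->
  exists2 V : 'M[R]_(b (p.+1 + j), b r),
    mx_in_mpow k V & W = (d (p + j))^T *m V.
Proof.
move=> hW cW.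
have h c : exists v, mx_in_mpow k v /\ row c W^T = v *m d (p + j).
  by apply: exact_ge (cW c); apply/mx_in_mpow_row/mx_in_mpow_tr.
have [f hf] := fin_all_exists h; exists (\matrix_c f c)^T.
  by move=> a c; rewrite 2!mxE; case: (hf c).
apply: trmx_inj; rewrite trmx_mul !trmxK; apply/row_matrixP => c.
by rewrite row_mul rowK; case: (hf c).
Qed.

(** Induction on r. With W = (d (x) 1) V, the Leibniz rule leaves only the product of (1 (x) d) V,
    which lies in m^(k + 1) and has second degree one lower; at r = 0 nothing is left. *)
Lemma prod_tensor_boundary r p (W : 'M[R]_(b (p + j), b r)) n :
  mx_in_mpow k.+1 W -> (forall c, cycle (row c W^T)) ->
  (forall a, cycle (row a W)) ->
  exists2 v, mx_in_mpow k v & prod_tensor n W = v *m d n.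
Proof.
elim: r p W => [|r IH] p W hW cW rW; have [V hV defW] := pow_exact_tensor hW cW.
  exists (prod_tensor n.+1 V); first exact: prod_tensor_in_mpow.
  by rewrite prod_tensor0_d -defW.
have [||a|v hv defv] := IH p.+1 (V *m d r).
- by rewrite -addn1; apply: mx_in_mpowM => //; apply: d_in_m.
(* The two partial differentials commute, and 1 (x) d kills W. *)
- move=> c /=; rewrite -row_mul -[d (p + j)]trmxK -trmx_mul mulmxA -defW.
  suff -> : W *m d r = 0 by rewrite trmx0 row0.
  by apply/row_matrixP => a; rewrite row_mul row0; exact: rW a.
- by rewrite row_mul; apply: boundary_cycle.
exists (prod_tensor n.+1 V + (-1) ^+ p *: v).
  by apply: mx_in_mpowD; [exact: prod_tensor_in_mpow|exact: mx_in_mpowZ].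
by rewrite mulmxDl prod_tensorS_d -defW -scalemxAl -defv subrK.
Qed.

End Zigzag.

End Product.

(** In y (x) u the columns are multiples of y by coordinates of u, which lie in m^(k + 1), and the
    rows are multiples of u; so all of them are cycles. *)
Lemma pow_exact_all k j (y : 'rV[R]_(b j)) :
  (forall i, (j <= i)%N -> pow_exact k i) -> ~ mx_in_mpow 1 y ->
  (forall a : R, mpow k.+1 a -> cycle (a *: y)) ->
  forall i, pow_exact k i.
Proof.
move=> hj hy cy i u hu cu.
have [a0 ya0] : exists a0, y 0 a0 \is a GRing.unit.
  apply/existsP; apply: contraT; rewrite negb_exists => /forallP hn.
  by case: hy => a c; rewrite ord1; apply/(mpow1P Hloc); apply: hn.
have hex p : pow_exact k (p + j) by apply: hj; rewrite leq_addl.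
have [|c|a|v hv defu] := prod_tensor_boundary y a0 hex (p := 0)
  (W := y^T *m u) i.
- exact: mx_in_mpowMl.
- rewrite trmx_mul trmxK row_mul.
  rewrite (_ : row c u^T = (u 0 c)%:M) ?mul_scalar_mx; first exact: cy.
  by apply/matrixP => k' l; rewrite !mxE !ord1 eqxx mulr1n.
- rewrite row_mul (_ : row a y^T = (y 0 a)%:M) ?mul_scalar_mx.
    case: (i) u cu {hu} => [|i'] u /= cu; first exact: mx_in_mpowZ.
    by rewrite -scalemxAl cu scaler0.
  by apply/matrixP => k' l; rewrite !mxE !ord1 eqxx mulr1n.
by exists v; split=> //; rewrite -defu prod_tensor_unit.
Qed.

(** * Descent under m^4 = 0 *)

Hypothesis Hm4 : forall x : R, mpow 4 x -> x = 0.

Lemma mx_in_mpow4 m n (A : 'M[R]_(m, n)) : mx_in_mpow 4 A -> A = 0.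
Proof. by move=> hA; apply/matrixP => i j; rewrite mxE; apply: Hm4. Qed.

Lemma cycle_in_mpow3 n (x : 'rV[R]_(b n)) : mx_in_mpow 3 x -> cycle x.
Proof.
case: n x => [|n] x hx /=; first by move=> i j; do 2!apply: mpow_pred.
by apply/mx_in_mpow4/(mx_in_mpowM (p := 3) (q := 1)); last exact: d_in_m.
Qed.

(* A nonzero element of m^3 multiplies every free module into cycles. *)
Lemma rank_gt0 (s : R) : mpow 3 s -> s != 0 -> forall n, (0 < b n)%N.
Proof.
move=> hs s0; elim=> [|n IH].
  rewrite lt0n; apply/eqP => b0; case: Hres => _ _ [x hx] _; apply: hx.
  rewrite mxE big1; first exact: in_m0.
  by move=> i; have := ltn_ord i; rewrite {2}b0.
rewrite lt0n; apply/eqP => b0.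
pose x : 'rV[R]_(b n) := s *: delta_mx 0 (Ordinal IH).
have hx : mx_in_mpow 3 x by move=> i j; rewrite mxE mulrC; apply: mpowMl.
have [y] := cycle_boundary (cycle_in_mpow3 hx).
move/matrixP/(_ 0 (Ordinal IH)); rewrite !mxE !eqxx mulr1 big1.
  by move/eqP; rewrite (negPf s0).
by move=> i; have := ltn_ord i; rewrite {2}b0.
Qed.

Lemma pow_exact2_all N :
  (forall i, (N <= i)%N -> pow_exact 2 i) -> forall i, pow_exact 2 i.
Proof.
move=> hN.
have [[s [hs s0]]|hm3] := classic (exists s : R, mpow 3 s /\ s != 0).
  pose a0 := Ordinal (rank_gt0 hs s0 N).
  apply: (pow_exact_all (j := N) (y := delta_mx 0 a0)) => // [hy|a ha].
    by have /mpow1P := hy 0 a0; rewrite mxE !eqxx /in_m unitr1 => /(_ Hloc).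
  by apply: cycle_in_mpow3 => i j; rewrite mxE mulrC; apply: mpowMl.
(* Here m^3 = 0, so x = 0. *)
move=> i x hx _; exists 0; split; first by move=> k l; rewrite mxE; apply: mpow0.
rewrite mul0mx; apply/matrixP => k l; rewrite [RHS]mxE.
by apply/eqP/negPn/negP => h; apply: hm3; exists (x k l).
Qed.

Lemma pow_exact1_all N :
  (forall i, (N <= i)%N -> pow_exact 1 i) -> forall i, pow_exact 1 i.
Proof.
elim: N => [|n IH] hN i; first exact: hN.
apply: IH => {}i; rewrite leq_eqVlt => /predU1P[<-{i}|]; last exact: hN.
move=> u hu cu; have [y defu] := cycle_boundary cu.
have [hy|hy] := classic (mx_in_mpow 1 y); first by exists y.
apply: (pow_exact_all (j := n.+1) (y := y)) => // a ha /=.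
rewrite -scalemxAl -defu; apply: mx_in_mpow4 => k l; rewrite mxE.
exact: (mpowM (q := 2) ha (hu k l)).
Qed.

(** * Linearity defect in terms of exactness *)

Lemma lin_homology_zero p i (x : 'rV[R]_(b i)) :
  ~ lin_homology_nonzero d i -> mx_in_mpow p x -> cycle x ->
  exists (y : 'rV[R]_(b i.+1)) (z : 'rV[R]_(b i)),
    [/\ mx_in_mpow p.-1 y, mx_in_mpow p.+1 z & x = y *m d i + z].
Proof.
move=> h hx cx; apply: NNPP => hn; apply: h; exists p, x; split.
- exact/rv_in_mpowP.
- case: i x cx {hn hx} => [//|i] x /= -> k; rewrite mxE; exact: mpow0.
by case=> y [z [_ hy hz defx]]; apply: hn; exists y, z; split=> //; apply/rv_in_mpowP.
Qed.

Lemma ld_le_pow_exact2 N i : ld_le d N -> (N < i)%N -> pow_exact 2 i.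
Proof.
move=> hN /hN hi x hx cx; have [y [z [hy hz ->]]] := lin_homology_zero hi hx cx.
by exists y; split=> //; rewrite (mx_in_mpow4 hz) addr0.
Qed.

(** The linear part lifts x up to an error z in m^3, which is a cycle and is lifted by exactness for
    k = 2. *)
Lemma ld_le_pow_exact1 N i : ld_le d N -> (N < i)%N -> pow_exact 1 i.
Proof.
move=> hN hi x hx cx.
have [y [z [hy hz defx]]] := lin_homology_zero (hN _ hi) hx cx.
have [v [hv defz]] := ld_le_pow_exact2 hN hi hz (cycle_in_mpow3 hz).
exists (y + v); split; last by rewrite mulmxDl -defz.
by apply: mx_in_mpowD => // k l; apply: mpow_pred.
Qed.

Lemma pow_exact_ld_eq0 :
  (forall i, pow_exact 1 i) -> (forall i, pow_exact 2 i) -> ld_eq0 d.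
Proof.
move=> h1 h2; split.
  case: Hres => _ _ [x hx] _; exists 0%N, x; split=> //.
  case=> y [z [[//|->] _ /rv_in_mpowP hz defx]]; apply: hx.
  by apply/mpow1P => //; apply: mx_in_mpowMr; rewrite defx mul0mx add0r.
case=> [//|i] _ [p [x [/rv_in_mpowP hx /rv_in_mpowP cx []]]].
(* For p = 0 and p = 1, exactness gives v in m^(p + 1) with d v = d x, and x - v is a boundary. For
   p = 2 and p = 3, x is itself a cycle and lifts to m^(p - 1). Beyond that, x = 0. *)
case: p hx cx => [|[|[|[|p]]]] hx cx.
- have [v [hv defv]] := h1 i _ cx (boundary_cycle x).
  have [w defw] : exists w, x - v = w *m d i.+1.
    by apply: cycle_boundary; rewrite /= mulmxBl defv subrr.
  (* At p = 0 no boundary may be used, but x = v + d w already has entries in m by minimality. *)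
  exists 0, x; split; [by right| | |by rewrite mul0mx add0r].
    by move=> k; rewrite mxE; apply: mpow0.
  apply/rv_in_mpowP; rewrite -(subrK v x) defw; apply: mx_in_mpowD => //.
  by apply: mx_in_mpowMl; apply: d_in_m.
- have [v [hv defv]] := h2 i _ cx (boundary_cycle x).
  have [w defw] : exists w, x - v = w *m d i.+1.
    by apply: cycle_boundary; rewrite /= mulmxBl defv subrr.
  by exists w, v; split; [left| |exact/rv_in_mpowP|rewrite -defw subrK].
- have [v [hv defv]] := h1 i.+1 x hx (mx_in_mpow4 cx).
  exists v, 0; split; [by left|exact/rv_in_mpowP| |by rewrite addr0].
  by move=> k; rewrite mxE; apply: mpow0.
- have [v [hv defv]] := h2 i.+1 x hx (cycle_in_mpow3 hx).
  exists v, 0; split; [by left|exact/rv_in_mpowP| |by rewrite addr0].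
  by move=> k; rewrite mxE; apply: mpow0.
exists 0, 0; split; try (by move=> k; rewrite mxE; apply: mpow0).
  by left.
rewrite mul0mx addr0; apply: mx_in_mpow4 => k l.
by elim: p hx {cx} => [|p IH] hx; [exact: hx|apply: IH => k' l'; apply: mpow_pred].
Qed.

End MinimalResolution.

Theorem theorem2p7 (R : comUnitRingType)
  (Hloc : is_local R) (Hnoeth : noetherian R) (Hart : artinian R)
  (Hm4 : forall x : R, mpow 4 x -> x = 0)
  (b : nat -> nat) (d : forall n, 'M[R]_(b n.+1, b n)) (e : 'cV[R]_(b 0%N))
  (Hres : is_free_resolution_of_k d e) (Hmin : is_minimal d) :
  ld_finite d -> ld_eq0 d.
Proof.
case=> N hN; apply: (pow_exact_ld_eq0 Hloc Hres Hmin Hm4).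
  apply: (pow_exact1_all Hloc Hres Hmin Hm4 (N := N.+1)) => i.
  exact: (ld_le_pow_exact1 Hloc Hmin Hm4 hN).
apply: (pow_exact2_all Hloc Hres Hmin Hm4 (N := N.+1)) => i.
exact: (ld_le_pow_exact2 Hm4 hN).
Qed.
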